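(* Let $\sigma>0$. For each $n\ge 1$ one observes the sequence $y_j=\theta_j+\sigma n^{-1/2}\xi_j$, $j\ge 1$, where $\xi_1,\xi_2,\dots$ are i.i.d. $N(0,1)$ and $\boldsymbol\theta=(\theta_j)_{j\ge1}\in\ell^2$ is unknown (equivalently, one observes $dY_n(t)=f(t)\,dt+\sigma n^{-1/2}\,dw(t)$, $t\in[0,1]$, with $w$ a standard Wiener process and $\theta_j=\int_0^1 f\phi_j\,dt$ for an orthonormal basis $(\phi_j)$ of $\mathbb{L}_2(0,1)$). Let $U\subset\ell^2$ be bounded, convex and center-symmetric (i.e. $\boldsymbol\theta\in U$ implies $-\boldsymbol\theta\in U$). For a sequence $\rho_n>0$ put $V_n=\{\boldsymbol\theta\in U:\ \|\boldsymbol\theta\|\ge\rho_n\}$ and consider testing $H_0:\boldsymbol\theta=0$ against $H_n:\boldsymbol\theta\in V_n$. Then there exist a sequence $\rho_n\to0$ and a sequence of tests $K_n$ with $$\limsup_{n\to\infty}\Big(\alpha(K_n)+\sup_{\boldsymbol\theta\in V_n}\beta(K_n,\boldsymbol\theta)\Big)<1$$ if and only if $U$ is relatively compact in $\ell^2$.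
   Context: $\alpha(K_n)$ denotes the type I error probability of the test $K_n$ (under $\boldsymbol\theta=0$) and $\beta(K_n,\boldsymbol\theta)$ its type II error probability under the alternative $\boldsymbol\theta$. Tests are arbitrary measurable functions of the observations with values in $\{0,1\}$. *)

(* Defs.v *)
From HB Require Import structures.
From mathcomp Require Import all_boot all_order all_algebra.
From mathcomp Require Import all_classical all_reals all_analysis.
Set Implicit Arguments. Unset Strict Implicit. Unset Printing Implicit Defensive.
Import Order.TTheory GRing.Theory Num.Theory.
Import numFieldNormedType.Exports.
Local Open Scope classical_set_scope.
Local Open Scope ring_scope.

Section defs.
Context {R : realType}.

Definition in_l2 (th : nat -> R) : Prop := cvg (series (fun j => th j ^+ 2) @ \oo).
Definition l2norm (th : nat -> R) : R :=
  Num.sqrt (limn (series (fun j => th j ^+ 2))).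

Definition l2_bounded (U : set (nat -> R)) : Prop :=
  exists M : R, forall th, U th -> l2norm th <= M.
Definition l2_convex (U : set (nat -> R)) : Prop :=
  forall th eta (t : R), U th -> U eta -> 0 <= t <= 1 ->
    U (fun j => t * th j + (1 - t) * eta j).
Definition center_symmetric (U : set (nat -> R)) : Prop :=
  forall th, U th -> U (fun j => - th j).

Definition l2_rel_compact (U : set (nat -> R)) : Prop :=
  forall u : nat -> (nat -> R), (forall k, U (u k)) ->
    exists (phi : nat -> nat) (l : nat -> R),
      (forall k, (phi k < phi k.+1)%N) /\ in_l2 l /\
      (fun k => l2norm (fun j => u (phi k) j - l j)) @ \oo --> (0 : R).

Definition seq_measurable (A : set (nat -> R)) : Prop :=
  <<s \bigcup_(j in [set: nat])
        preimage_set_system setT (fun y : nat -> R => y j) measurable >> A.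

Definition is_test (K : (nat -> R) -> bool) : Prop :=
  seq_measurable (K @^-1` [set true]).

Definition iid_std_normal d (Omega : measurableType d) (P : probability Omega R)
  (xi : nat -> Omega -> R) : Prop :=
  (forall j, measurable_fun setT (xi j)) /\
  (forall j (B : set R), measurable B ->
     P (xi j @^-1` B) = normal_prob 0 1 B) /\
  (forall (J : seq nat) (B : nat -> set R), uniq J ->
     (forall j, measurable (B j)) ->
     P (\bigcap_(j in [set` J]) (xi j @^-1` B j)) =
       (\prod_(j <- J) P (xi j @^-1` B j))%E).

(** Observation y_j = theta_j + sigma n^{-1/2} xi_j, where the sample size is
    n.+1 (so that n ranges over n >= 1). *)
Definition obs d (Omega : measurableType d) (xi : nat -> Omega -> R) (sigma : R)
  (n : nat) (th : nat -> R) (w : Omega) : nat -> R :=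
  fun j => th j + sigma * (Num.sqrt (n.+1)%:R)^-1 * xi j w.

Definition alpha_err d (Omega : measurableType d) (P : probability Omega R)
  (xi : nat -> Omega -> R) sigma n (K : (nat -> R) -> bool) : \bar R :=
  P [set w | K (obs xi sigma n (fun _ => 0) w)].

Definition beta_err d (Omega : measurableType d) (P : probability Omega R)
  (xi : nat -> Omega -> R) sigma n (K : (nat -> R) -> bool) (th : nat -> R)
  : \bar R :=
  P [set w | ~~ K (obs xi sigma n th w)].

Definition Vset (U : set (nat -> R)) (rho : R) : set (nat -> R) :=
  [set th | U th /\ rho <= l2norm th].

End defs.

(* Main.v *)
Require Import Defs.
From HB Require Import structures.
From mathcomp Require Import all_boot all_order all_algebra.
From mathcomp Require Import all_classical all_reals all_analysis.
From mathcomp Require Import measurable_realfun ring lra.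
Import Order.TTheory GRing.Theory Num.Theory.
Import numFieldNormedType.Exports.
Local Open Scope classical_set_scope.
Local Open Scope ring_scope.

(** Non-compactness defeats every test because the Gaussian shift measures
    depend continuously on the coordinates of the shift, uniformly on
    l2-balls. By Cameron-Martin, translating finitely many coordinates by
    theta multiplies the law of the noise by a likelihood ratio Z whose second
    moment is exp |theta|^2. This bounds P_theta(B) in terms of P_0(B) for
    cylinders, hence for all measurable sets, and uniformly for |theta| <= M.
    Approximating the rejection region of a fixed test by a cylinder, one finds
    that the power of the test at theta exceeds its level by an arbitrarily
    small amount once the first D coordinates of theta are small. A consistent
    sequence of tests therefore forces: for every rho there are D and eps such
    that every theta in U with |theta_j| <= eps for j < D has norm < rho.
    Applied to (u_p - u_q) / 2, which lies in U by convexity and symmetry, this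
    makes a coordinatewise convergent subsequence of (u_p) Cauchy in l2.
    Conversely, if U is relatively compact then, uniformly on U, half of the
    squared norm is carried by finitely many coordinates whenever
    |theta| >= rho; a chi-square test on these coordinates has small errors for
    n large, and a diagonal choice lets rho tend to 0. *)

(** Take for [m n] the largest [i <= n] with [N i <= n]. If the [k]-th test is good from sample size
    [N k] on, this lets [k] grow with [n] while staying admissible. *)
Lemma diagonal_index (N : nat -> nat) : exists m : nat -> nat,
  (forall n, (N 0 <= n)%N -> (N (m n) <= n)%N) /\
  (forall k, exists n0, forall n, (n0 <= n)%N -> (k <= m n)%N).
Proof.
exists (fun n => \max_(i < n.+1 | (N i <= n)%N) i)%N; split.
  move=> n N0n; have cond : (0 < #|[pred i : 'I_n.+1 | (N i <= n)%N]|)%N.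
    by apply/card_gt0P; exists ord0.
  by have [i Ni ->] := eq_bigmax_cond (fun i : 'I_n.+1 => i : nat) cond.
move=> k; exists (maxn k (N k)) => n; rewrite geq_max => /andP[kn Nkn].
exact: (@leq_bigmax_cond _ (fun i : 'I_n.+1 => (N i <= n)%N)
  (fun i => i : nat) (Ordinal (kn : (k < n.+1)%N))).
Qed.

Lemma measurableY {d : measure_display} {T : measurableType d} (A B : set T) :
  measurable A -> measurable B -> measurable (A `+` B).
Proof.
by move=> mA mB; rewrite setY_def; apply: measurableU; exact: measurableD.
Qed.

(** * Square-summable sequences *)

Section square_summable.
Context {R : realType}.
Implicit Types (th eta l : nat -> R) (U : set (nat -> R)).

Lemma nondecreasing_sum_sqr th :
  nondecreasing_seq (series (fun j => th j ^+ 2)).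
Proof. by apply: nondecreasing_series => n _ _; exact: sqr_ge0. Qed.

Lemma l2norm_ge0 th : 0 <= l2norm th.
Proof. exact: sqrtr_ge0. Qed.

Lemma sum_sqr_le_l2norm th N : in_l2 th ->
  \sum_(j < N) th j ^+ 2 <= l2norm th ^+ 2.
Proof.
move=> h; have le N' := nondecreasing_cvgn_le (nondecreasing_sum_sqr th) h N'.
rewrite sqr_sqrtr; last by apply: le_trans (le 0%N); rewrite /series/= big_nil.
by have := le N; rewrite /series/= big_mkord.
Qed.

Lemma l2_of_sum_sqr_le th C : (forall N, \sum_(j < N) th j ^+ 2 <= C) ->
  in_l2 th /\ l2norm th ^+ 2 <= C.
Proof.
move=> h.
have h' N : series (fun j => th j ^+ 2) N <= C by rewrite /series/= big_mkord.
have cv : in_l2 th.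
  apply: nondecreasing_is_cvgn; first exact: nondecreasing_sum_sqr.
  by exists C => _ [N _ <-].
split => //; rewrite /l2norm sqr_sqrtr.
  by apply: limr_le => //; exact: nearW.
have := nondecreasing_cvgn_le (nondecreasing_sum_sqr th) cv 0%N.
by apply: le_trans; rewrite /series/= big_nil.
Qed.

Lemma in_l2B th eta : in_l2 th -> in_l2 eta -> in_l2 (fun j => th j - eta j).
Proof.
move=> h1 h2.
apply: (proj1 (l2_of_sum_sqr_le _
  (2 * l2norm th ^+ 2 + 2 * l2norm eta ^+ 2) _)).
move=> N.
apply: le_trans (lerD (ler_wpM2l _ (sum_sqr_le_l2norm th N h1))
                      (ler_wpM2l _ (sum_sqr_le_l2norm eta N h2))) => //.
rewrite !mulr_sumr -big_split/=; apply: ler_sum => j _.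
by have := sqr_ge0 (th j + eta j); nra.
Qed.

(** Two terms close to the coordinatewise limit [l] on the first [D] coordinates have a
    half-difference in [U] with a small head, hence of small norm. Letting one of them tend to [l]
    bounds the distance from the other to [l]. *)
Lemma small_head_rel_compact U :
  (forall th, U th -> in_l2 th) ->
  l2_bounded U -> l2_convex U -> center_symmetric U ->
  (forall rho, 0 < rho -> exists D eps, 0 < eps /\ forall th, U th ->
     (forall j, (j < D)%N -> `|th j| <= eps) -> l2norm th < rho) ->
  l2_rel_compact U.
Proof.
move=> Ul2 [M UM] Uconv Usym Usmall u Uu.
(* Convergence of all coordinates along one ultrafilter replaces the extraction
   of a diagonal subsequence. *)
have [F [FU oF]] := ultraFilterLemma (@eventually_filter).
have FF : ProperFilter F by exact: ultra_proper.
have uM p j : u p j \in `[- M, M].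
  rewrite in_itv/= -ler_norml.
  apply: le_trans (UM _ (Uu p)).
  rewrite -ler_sqr ?nnegrE ?l2norm_ge0// real_normK ?num_real//.
  apply: le_trans (sum_sqr_le_l2norm _ j.+1 (Ul2 _ (Uu p))).
  by rewrite big_ord_recr/= lerDr sumr_ge0// => i _; exact: sqr_ge0.
have lim_ j : exists l : R, u p j @[p --> F] --> l.
  have FuM : (u p j @[p --> F]) `[- M, M]%classic.
    by apply: (@filterS _ F _ setT) => [p _|]; [exact: uM|exact: filterT].
  have [l [_ cl]] := segment_compact _ FuM.
  exists l => B nB /=.
  (* A cluster point of an ultrafilter is its limit: if the preimage of [B] were not in [F], its
     complement would be, and the cluster property would give a point both in [B] and outside it. *)
  have [//|FnB] := in_ultra_setVsetC ((fun p => u p j) @^-1` B) FU.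
  have FnB' : (u p j @[p --> F]) (~` B) by [].
  by have [x [nBx Bx]] := cl _ _ FnB' nB.
have [l ul] := choice lim_.
have l_sum p N : (\sum_(j < N) (u p j - u q j) ^+ 2) @[q --> F] -->
    \sum_(j < N) (u p j - l j) ^+ 2.
  elim: N => [|N IH].
    rewrite big_ord0; under eq_fun do rewrite big_ord0; exact: cvg_cst.
  rewrite big_ord_recr/=; under eq_fun do rewrite big_ord_recr/=.
  apply: cvgD => //; under eq_fun do rewrite expr2.
  by rewrite expr2; apply: cvgM; apply: cvgB => //; exact: cvg_cst.
have close rho : 0 < rho -> \forall p \near F,
    in_l2 (fun j => u p j - l j) /\ l2norm (fun j => u p j - l j) <= 2 * rho.
  move=> rho0; have [D [eps [eps0 hD]]] := Usmall _ rho0.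
  have FG : F [set p | forall j, (j < D)%N -> `|l j - u p j| <= eps].
    elim: D {hD} => [|D IH]; first by apply: filterS filterT.
    have /cvgrPdist_le/(_ _ eps0) := ul D.
    move=> FD; apply: filterS (filterI IH FD) => p [h1 h2] j.
    rewrite ltnS leq_eqVlt => /orP[/eqP->//|]; exact: h1.
  apply: filterS (FG) => p Gp.
  have le4 N : \sum_(j < N) (u p j - l j) ^+ 2 <= (2 * rho) ^+ 2.
    (* A partial sum passes to the limit along [F], so it is enough to bound it with [u q] in place
       of [l], for [F]-many [q]. *)
    apply: (cvgr_to_le (l_sum p N)).
    apply: filterS (FG) => q Gq.
    (* Half of [u p - u q], written as a convex combination of [u p] and [- u q]. Its head is at
       most [eps] since [u p] and [u q] are both within [eps] of [l] there. *)
    pose v j := 2^-1 * u p j + (1 - 2^-1) * - u q j.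
    have Uv : U v by apply: Uconv => //; [exact: Usym|lra].
    have vrho : l2norm v < rho.
      apply: hD => // j jD; have := Gp j jD; have := Gq j jD.
      rewrite /v !ler_norml => /andP[? ?] /andP[? ?]; lra.
    have := sum_sqr_le_l2norm v N (Ul2 _ Uv).
    have -> : \sum_(j < N) v j ^+ 2 = 4^-1 * \sum_(j < N) (u p j - u q j) ^+ 2.
      by rewrite mulr_sumr; apply: eq_bigr => j _; rewrite /v; field.
    by have := l2norm_ge0 v; nra.
  have [h1 h2] := l2_of_sum_sqr_le (fun j => u p j - l j) _ le4; split => //.
  by rewrite -ler_sqr ?nnegrE ?l2norm_ge0//; lra.
have next_ k n : exists p, (n < p)%N /\
    l2norm (fun j => u p j - l j) <= k.+1%:R^-1.
  have k0 : 0 < 2^-1 * k.+1%:R^-1 :> R by rewrite mulr_gt0// invr_gt0 ltr0n.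
  (* [F] refines the filter of neighbourhoods of infinity, so [p] can be taken beyond [n]; this
     makes [phi] strictly increasing. *)
  have Fn : F [set p | (n < p)%N] by apply: oF; exists n.+1.
  have [p [np [_ hp]]] := filter_ex (filterI Fn (close _ k0)).
  by exists p; split => //; apply: le_trans hp _; rewrite mulrA divff// mul1r.
have [next nextP] := choice (fun kn : nat * nat => next_ kn.1 kn.2).
pose phi := fix phi k := if k is k'.+1 then next (k, phi k') else next (0, 0)%N.
have phiP k : l2norm (fun j => u (phi k) j - l j) <= k.+1%:R^-1.
  by case: k => [|k]; [have [] := nextP (0, 0)%N|have [] := nextP (k.+1, phi k)].
exists phi, l; split.
  by move=> k; rewrite /=; have [] := nextP (k.+1, phi k).
split.
  have [p [h _]] := filter_ex (close 1 ltr01).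
  have := in_l2B _ _ (Ul2 _ (Uu p)) h.
  by congr in_l2; apply/funext => j; ring.
apply: (squeeze_cvgr (f := fun=> 0) (h := harmonic)); last exact: cvg_harmonic.
  by apply: nearW => k; rewrite l2norm_ge0 phiP.
exact: cvg_cst.
Qed.

(** Otherwise every [D] has a bad sequence [u D]. Far along a subsequence converging to [l], the
    head of [u D] carries less than [rho ^+ 2 / 2] and its tail, compared with the tail of [l], at
    most [rho ^+ 2 / 4], which is too little for a norm of at least [rho]. *)
Lemma rel_compact_head U (rho : R) :
  (forall th, U th -> in_l2 th) -> l2_rel_compact U -> 0 < rho ->
  exists D, forall th, U th -> rho <= l2norm th ->
    rho ^+ 2 / 2 <= \sum_(j < D) th j ^+ 2.
Proof.
move=> Ul2 Ucpt rho0; apply: contrapT => /forallNP hD.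
have bad D : exists th, [/\ U th, rho <= l2norm th &
    \sum_(j < D) th j ^+ 2 < rho ^+ 2 / 2].
  apply: contrapT => /forallNP h; apply: (hD D) => th Uth rth.
  by rewrite leNgt; apply/negP => lt; exact: (h th).
have [u uP] := choice bad.
have [phi [l [phi_lt [l2l cv]]]] :=
  Ucpt u (fun k => let: And3 h _ _ := uP k in h).
have phi_ge k : (k <= phi k)%N.
  by elim: k => // k IH; exact: leq_ltn_trans IH (phi_lt k).
pose L := l2norm l ^+ 2.
have r16 : 0 < rho ^+ 2 / 16 by rewrite divr_gt0// exprn_gt0.
have [D0 hD0] : exists D0, L - rho ^+ 2 / 16 < \sum_(j < D0) l j ^+ 2.
  apply: contrapT => /forallNP h.
  have [_] : in_l2 l /\ L <= L - rho ^+ 2 / 16.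
    by apply: l2_of_sum_sqr_le => N; rewrite leNgt; apply/negP; exact: h.
  lra.
have r4 : 0 < rho / 4 by lra.
have /cvgrPdist_le/(_ _ r4)[N0 _ hN0] := cv.
(* [D] is both the index of the bad sequence and the place where it is cut. *)
pose k := maxn N0 D0; set D := phi k; pose th := u D.
have Dk : (D0 <= D)%N by rewrite (leq_trans _ (phi_ge k))// leq_maxr.
have [Uth rth sth] := uP D; rewrite -/th in Uth rth sth.
have dist : l2norm (fun j => th j - l j) ^+ 2 <= rho ^+ 2 / 16.
  have := hN0 k (leq_maxl _ _); rewrite sub0r normrN ger0_norm ?l2norm_ge0//.
  rewrite -/D -/th; have := l2norm_ge0 (fun j => th j - l j).
  by rewrite /=; nra.
have l2d := in_l2B _ _ (Ul2 _ Uth) l2l.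
have [_] : in_l2 th /\ l2norm th ^+ 2 <= rho ^+ 2 / 2 + rho ^+ 2 / 4.
  apply: l2_of_sum_sqr_le => N.
  apply: (@le_trans _ _ (\sum_(0 <= j < D + N) th j ^+ 2)).
    rewrite -(big_mkord predT (fun j => th j ^+ 2)).
    by have := nondecreasing_sum_sqr th _ _ (leq_addl D N).
  rewrite (big_cat_nat (n := D)) ?leq_addr//= big_mkord.
  apply: lerD; first exact: ltW.
  have hl : \sum_(D <= j < D + N) l j ^+ 2 <= rho ^+ 2 / 16.
    have := sum_sqr_le_l2norm l (D + N) l2l.
    rewrite -(big_mkord predT (fun j => l j ^+ 2)).
    rewrite (big_cat_nat (n := D)) ?leq_addr//=.
    have := nondecreasing_sum_sqr l _ _ Dk; rewrite /series/= !big_mkord -/L.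
    lra.
  have hd : \sum_(D <= j < D + N) (th j - l j) ^+ 2 <= rho ^+ 2 / 16.
    have := sum_sqr_le_l2norm _ (D + N) l2d.
    rewrite -(big_mkord predT (fun j => (th j - l j) ^+ 2)).
    rewrite (big_cat_nat (n := D)) ?leq_addr//=.
    have : 0 <= \sum_(0 <= j < D) (th j - l j) ^+ 2.
      by apply: sumr_ge0 => j _; exact: sqr_ge0.
    lra.
  (* Termwise [x ^+ 2 <= 2 * (x - y) ^+ 2 + 2 * y ^+ 2]; the difference of the two sides is
     [(x - 2 * y) ^+ 2]. *)
  apply: (@le_trans _ _ (2 * \sum_(D <= j < D + N) (th j - l j) ^+ 2 +
                         2 * \sum_(D <= j < D + N) l j ^+ 2)); last lra.
  rewrite !mulr_sumr -big_split/=; apply: ler_sum => j _.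
  by have := sqr_ge0 (th j - 2 * l j); nra.
by nra.
Qed.

End square_summable.

(** * The product sigma-algebra *)

Section sequence_space.
Context {R : realType}.

(** Repeats the generators in [seq_measurable], so that [is_test] unfolds to measurability in
    [seqspace]. *)
Definition coord_sets : set (set (nat -> R)) :=
  \bigcup_(j in [set: nat])
    preimage_set_system setT (fun y : nat -> R => y j) measurable.

Local Notation seqspace := (g_sigma_algebraType coord_sets).

Lemma measurable_coord j : measurable_fun setT (fun x : seqspace => x j).
Proof.
by move=> _ B mB; apply: sub_sigma_algebra; exists j => //; exists B.
Qed.

Lemma measurable_fun_seqspace d (T : measurableType d) (f : T -> seqspace) :
  (forall j, measurable_fun setT (fun t => f t j)) -> measurable_fun setT f.
Proof.
move=> mf; apply: (@measurability _ _ _ seqspace setT f coord_sets) => //.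
move=> _ [A [j _ [B mB <-]] <-].
rewrite !setTI.
have := mf j measurableT B mB; by rewrite setTI.
Qed.

Lemma measurable_rectangle (B : nat -> set R) (N : nat) :
  (forall j, measurable (B j)) -> (forall j, (N <= j)%N -> B j = setT) ->
  measurable ([set x | forall j, B j (x j)] : set seqspace).
Proof.
move=> mB BN.
have -> : [set x : seqspace | forall j, B j (x j)] =
    \big[setI/setT]_(j < N) ((fun x : seqspace => x j) @^-1` B j).
  rewrite -(bigcap_mkord N (fun j => (fun x : seqspace => x j) @^-1` B j)).
  apply/seteqP; split => x /= h; first by move=> j _; exact: h.
  move=> j; case: (ltnP j N) => jN; first exact: h.
  by rewrite BN.
apply: bigsetI_measurable => j _; rewrite -[X in measurable X]setTI.
exact: measurable_coord.
Qed.

Definition rectangles : set (set seqspace) :=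
  [set A | exists (B : nat -> set R) (N : nat),
    [/\ forall j, measurable (B j), forall j, (N <= j)%N -> B j = setT &
        A = [set x | forall j, B j (x j)]]].

Lemma setI_closed_rectangles : setI_closed rectangles.
Proof.
move=> _ _ [B [N [mB BN ->]]] [C [M [mC CM ->]]].
exists (fun j => B j `&` C j), (maxn N M); split.
- by move=> j; exact: measurableI.
- by move=> j; rewrite geq_max => /andP[Nj Mj]; rewrite BN// CM// setIT.
- apply/seteqP; split => x /=; first by move=> [h1 h2] j; split.
  by move=> h; split => j; have [] := h j.
Qed.

Lemma measurable_rectangles : @measurable _ seqspace = <<s rectangles >>.
Proof.
apply/seteqP; split; last first.
  apply: smallest_sub; first exact: sigma_algebra_measurable.
  by move=> _ [B [N [mB BN ->]]]; exact: measurable_rectangle BN.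
apply: (@smallest_sub _ _ coord_sets); first exact: smallest_sigma_algebra.
move=> _ [j _ [B mB <-]]; apply: sub_sigma_algebra.
exists (fun i => if i == j then B else setT), j.+1; split.
- by move=> i; case: eqP.
- by move=> i ji; rewrite gtn_eqF.
- apply/seteqP; split => x /=; first by move=> [_ Bx] i; case: eqP => // ->.
  by move=> /(_ j); rewrite eqxx.
Qed.

Lemma eq_measure_rectangles (m1 m2 : {measure set seqspace -> \bar R}) :
  (m1 setT < +oo)%E -> (forall A, rectangles A -> m1 A = m2 A) ->
  forall A, measurable A -> m1 A = m2 A.
Proof.
move=> m1oo m12; apply: (measure_unique rectangles (fun=> setT)) => //.
- exact: measurable_rectangles.
- exact: setI_closed_rectangles.
- by move=> _; exists (fun=> setT), 0%N; split => //; apply/seteqP.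
- by rewrite bigcup_const.
Qed.

End sequence_space.

(** * Translations of the standard normal law *)

Section normal_shift.
Context {R : realType}.
Local Notation mu := (@lebesgue_measure R).

Lemma lebesgue_measureD (a : R) (A : set R) : measurable A ->
  pushforward mu ((fun x => x + a) : _ -> measurableTypeR R) A = mu A.
Proof.
move=> mA; apply/esym; apply: lebesgue_measure_unique mA.
  exact: measurable_funD.
move=> mD _ [[b c]] _ <-.
have E : (fun x : R => x + a) @^-1` `]b, c]%classic = `]b - a, c - a]%classic.
  by apply/seteqP; split => x /=; rewrite !in_itv/= => /andP[? ?];
    apply/andP; split; lra.
transitivity (mu `]b - a, c - a]%classic); last by rewrite -E.
rewrite !lebesgue_measure_itv/= !lte_fin ltrD2r.
by case: ifP => // _; rewrite -!EFinD; congr EFin; ring.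
Qed.

Lemma ge0_integral_translation (a : R) (f : R -> \bar R) :
  measurable_fun setT f -> (forall x, (0 <= f x)%E) ->
  (\int[mu]_x f (x + a)%R = \int[mu]_x f x)%E.
Proof.
move=> mf f0.
have mD : measurable_fun setT ((fun x => x + a) : _ -> measurableTypeR R).
  by apply: measurable_funD.
have := @ge0_integral_pushforward _ _ (measurableTypeR R) (measurableTypeR R) R
  _ mD mu setT f measurableT mf (fun x _ => f0 x).
rewrite preimage_setT => <-.
by apply: eq_measure_integral => A mA _; exact: lebesgue_measureD.
Qed.

(** Change of variables holds for the Radon-Nikodym derivative, which equals the density almost
    everywhere because both have the same integral over every measurable set. *)
Lemma ge0_integral_normal_prob (m s : R) (f : R -> \bar R) :
  measurable_fun setT f -> (forall x, (0 <= f x)%E) ->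
  (\int[normal_prob m s]_x f x = \int[mu]_x (f x * (normal_pdf m s x)%:E))%E.
Proof.
move=> mf f0; have dom := normal_prob_dominates m s.
rewrite -(Radon_Nikodym_SigmaFinite.change_of_variables dom)//.
have mpdf : measurable_fun setT (fun x => (normal_pdf m s x)%:E).
  by apply/measurable_EFinP; exact: measurable_normal_pdf.
have irn := Radon_Nikodym_SigmaFinite.f_integrable dom.
apply: ge0_ae_eq_integral => //.
- by apply: emeasurable_funM => //; exact: measurable_int irn.
- exact: emeasurable_funM.
- by move=> x _; rewrite mule_ge0// Radon_Nikodym_SigmaFinite.f_ge0.
- by move=> x _; rewrite mule_ge0// lee_fin normal_pdf_ge0.
have : ae_eq mu setT (Radon_Nikodym_SigmaFinite.f (normal_prob m s) mu)
    (fun x => (normal_pdf m s x)%:E).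
  apply: integral_ae_eq => // E _ mE.
  by rewrite -Radon_Nikodym_SigmaFinite.f_integral.
by apply: filterS => x /= h xT; rewrite h.
Qed.

(** The one-dimensional Cameron-Martin formula. *)
Lemma ge0_integral_normal_shift (a : R) (f : R -> \bar R) :
  measurable_fun setT f -> (forall x, (0 <= f x)%E) ->
  (\int[normal_prob 0%R 1%R]_x f (x + a)%R =
   \int[normal_prob 0%R 1%R]_x (f x * (expR (a * x - a ^+ 2 / 2))%:E))%E.
Proof.
move=> mf f0.
have mD : measurable_fun setT (fun x : R => x + a) by exact: measurable_funD.
have mE : measurable_fun setT (fun x => (expR (a * x - a ^+ 2 / 2))%:E).
  apply/measurable_EFinP; apply: measurableT_comp => //.
  by apply: measurable_funB => //; exact: measurable_funM.
have mpdf : measurable_fun setT (fun x : R => (normal_pdf 0 1 x)%:E).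
  by apply/measurable_EFinP; exact: measurable_normal_pdf.
rewrite (@ge0_integral_normal_prob _ _ (fun x => f (x + a)))//; last first.
  exact: (measurableT_comp mf mD).
rewrite (@ge0_integral_normal_prob _ _
  (fun x => f x * (expR (a * x - a ^+ 2 / 2))%:E)%E); first last.
- by move=> x; rewrite mule_ge0// lee_fin expR_ge0.
- exact: emeasurable_funM.
(* Now both integrands contain [f (x + a)], and the weights agree because [(x + a) ^+ 2 / 2 = x ^+ 2
   / 2 + a * (x + a) - a ^+ 2 / 2]. *)
rewrite -[in RHS](ge0_integral_translation a); first last.
- by move=> x; rewrite !mule_ge0// lee_fin ?expR_ge0// normal_pdf_ge0.
- by do 2 apply: emeasurable_funM => //.
apply: eq_integral => x _; rewrite -muleA -EFinM; congr (_ * _%:E)%E.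
rewrite !normal_pdfE ?oner_neq0// mulrCA -expRD; congr (_ * expR _).
by field.
Qed.

End normal_shift.

(** * Gaussian noise *)

Section gaussian_noise.
Context {R : realType} {d : measure_display} {Omega : measurableType d}.
Context {P : probability Omega R} {xi : nat -> Omega -> R}.
Context (iid : iid_std_normal P xi).
Local Notation seqspace := (g_sigma_algebraType (@coord_sets R)).
Local Notation gamma := (@normal_prob R 0 1).

Definition noise (w : Omega) : seqspace := fun j => xi j w.

Definition upd (j : nat) (a : R) (x : seqspace) : seqspace :=
  fun i => if i == j then a else x i.

Definition translate (th : nat -> R) (x : seqspace) : seqspace :=
  fun j => th j + x j.

Lemma measurable_noise : measurable_fun setT noise.
Proof. by apply: measurable_fun_seqspace => j; case: iid => + _; apply. Qed.

Lemma measurable_translate th : measurable_fun setT (translate th).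
Proof.
apply: measurable_fun_seqspace => j.
by apply: measurable_funD => //; exact: measurable_coord.
Qed.

Lemma noise_rectangle (B : nat -> set R) (N : nat) :
  (forall j, measurable (B j)) -> (forall j, (N <= j)%N -> B j = setT) ->
  P [set w | forall j, B j (xi j w)] = (\prod_(j < N) gamma (B j))%E.
Proof.
move=> mB BN; have [_ [law indep]] := iid.
have -> : [set w | forall j, B j (xi j w)] =
    \bigcap_(j in [set` iota 0 N]) (xi j @^-1` B j).
  apply/seteqP; split => w /= h j; first by move=> _; exact: h.
  case: (ltnP j N) => jN; last by rewrite BN.
  by apply: h => /=; rewrite mem_iota.
rewrite indep ?iota_uniq//.
rewrite -[RHS](big_mkord predT (fun j => gamma (B j))) /index_iota subn0.
by apply: eq_bigr => j _; rewrite law.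
Qed.

(** * Resampling and shifting one coordinate of the noise *)

Lemma measurable_resample j :
  measurable_fun setT (fun p : measurableTypeR R * Omega => upd j p.1 (noise p.2)).
Proof.
apply: measurable_fun_seqspace => i; rewrite /upd; case: (i == j).
  exact: (@measurable_fst _ _ (measurableTypeR R)).
by apply: (measurableT_comp _ measurable_snd); case: iid => + _; apply.
Qed.

(** Replacing coordinate [j] by an independent standard normal variable keeps the law of the noise.
    On a rectangle this amounts to pulling the factor [j] out of the product. *)
Lemma resample_rectangle j (A : set seqspace) : rectangles A ->
  P (noise @^-1` A) =
  (gamma \x P)%E ((fun p => upd j p.1 (noise p.2)) @^-1` A).
Proof.
move=> [B [N [mB BN ->]]].
pose B' i := if i == j then setT else B i.
have mB' i : measurable (B' i) by rewrite /B'; case: eqP.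
have -> : (fun p => upd j p.1 (noise p.2)) @^-1` [set x | forall i, B i (x i)] =
    B j `*` [set w | forall i, B' i (xi i w)].
  apply/seteqP; split => -[x w] /=; rewrite /upd /B' /noise => h.
    split; first by have := h j; rewrite eqxx.
    by move=> i; have := h i; case: (i == j).
  by move=> i; case: h => h1 h2; have := h2 i; case: eqP => // ->.
(* The product must run past [j] for its factor to occur. *)
pose M := maxn N j.+1.
have BM i : (M <= i)%N -> B i = setT by rewrite geq_max => /andP[/BN].
have BM' i : (M <= i)%N -> B' i = setT.
  by move=> /BM h; rewrite /B' h; case: ifP.
have mE : measurable [set w | forall i, B' i (xi i w)].
  rewrite -[X in measurable X]setTI.
  exact: (measurable_noise measurableT _ (measurable_rectangle _ _ mB' BM')).
transitivity (gamma (B j) * P [set w | forall i, B' i (xi i w)])%E; last first.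
  by rewrite product_measure1E//; exact: mB.
rewrite (noise_rectangle _ _ mB' BM').
rewrite /preimage/= (noise_rectangle _ _ mB BM).
have jM : (j < M)%N by rewrite leq_max leqnn orbT.
rewrite (bigD1 (Ordinal jM))//= [in RHS](bigD1 (Ordinal jM))//=.
have -> : B' j = setT by rewrite /B' eqxx.
rewrite probability_setT mul1e; congr (_ * _)%E.
by apply: eq_bigr => i; rewrite -val_eqE /B' /= => /negbTE ->.
Qed.

(** Coordinate [j] becomes an integration variable of its own, by Tonelli's theorem on the resampled
    noise. *)
Lemma ge0_integral_resample j (f : seqspace -> \bar R) :
  measurable_fun setT f -> (forall x, (0 <= f x)%E) ->
  (\int[P]_w f (noise w) =
   \int[gamma]_x \int[P]_w f (upd j x (noise w)))%E.
Proof.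
move=> mf f0.
have E1 := @ge0_integral_pushforward _ _ _ _ R _ measurable_noise P setT f
  measurableT mf (fun x _ => f0 x).
have E2 := @ge0_integral_pushforward _ _ _ _ R _ (measurable_resample j)
  (gamma \x P)%E setT f measurableT mf (fun x _ => f0 x).
have F := @fubini_tonelli1 _ _ (measurableTypeR R) Omega R gamma P
  (fun p => f (upd j p.1 (noise p.2)))
  (measurableT_comp mf (measurable_resample j)) (fun p => f0 _).
rewrite !preimage_setT in E1 E2.
apply: etrans (esym E1) _; apply: etrans (etrans E2 F).
apply: eq_measure_integral.
- exact: measurable_resample.
- exact: measurable_noise.
move=> mn mr A mA _.
apply: eq_measure_rectangles mA; last exact: resample_rectangle.
by rewrite /= /pushforward preimage_setT probability_setT ltry.
Qed.

(** After resampling, the shift only moves the fresh value [x] to [x + a], and the one-dimensional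
    formula applies to the partial integral [g]. *)
Lemma ge0_integral_shift1 j (a : R) (f : seqspace -> \bar R) :
  measurable_fun setT f -> (forall x, (0 <= f x)%E) ->
  (\int[P]_w f (translate (fun i => if i == j then a else 0%R) (noise w)) =
   \int[P]_w (f (noise w) * (expR (a * xi j w - a ^+ 2 / 2))%:E))%E.
Proof.
move=> mf f0; set e := (X in translate X).
pose g x := (\int[P]_w f (upd j x (noise w)))%E.
pose fZ (x : seqspace) := (f x * (expR (a * x j - a ^+ 2 / 2))%:E)%E.
have mZ : measurable_fun setT
    (fun x : seqspace => (expR (a * x j - a ^+ 2 / 2))%:E).
  apply/measurable_EFinP; apply: measurableT_comp => //.
  apply: measurable_funB => //; apply: measurable_funM => //.
  exact: measurable_coord.
have mg : measurable_fun setT g.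
  exact: (@measurable_fun_fubini_tonelli_F _ _ (measurableTypeR R) Omega R P
    (fun p => f (upd j p.1 (noise p.2)))
    (measurableT_comp mf (measurable_resample j)) (fun p => f0 _)).
have g0 x : (0 <= g x)%E by exact: integral_ge0.
transitivity (\int[gamma]_x g (x + a)%R)%E.
  rewrite (ge0_integral_resample j (fun x => f (translate e x)))//; last first.
    exact: (measurableT_comp mf (measurable_translate e)).
  apply: eq_integral => x _; apply: eq_integral => w _; congr f.
  apply/funext => i; rewrite /translate /upd /e.
  by case: ifP => _; rewrite ?add0r// addrC.
rewrite ge0_integral_normal_shift//.
rewrite (ge0_integral_resample j fZ); last 2 first.
- exact: emeasurable_funM.
- by move=> x; rewrite mule_ge0// lee_fin expR_ge0.
apply: eq_integral => x _.
under [RHS]eq_integral do rewrite /fZ [upd _ _ _ j]/upd eqxx.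
rewrite ge0_integralZr// ?lee_fin ?expR_ge0//.
by apply: (measurable_fun_pair2 (T1 := measurableTypeR R)
  (f := fun p => f (upd j p.1 (noise p.2))));
  exact: (measurableT_comp mf (measurable_resample j)).
Qed.

(** * The Cameron-Martin formula for finitely many coordinates *)

Definition truncseq (D : nat) (th : nat -> R) : nat -> R :=
  fun j => if (j < D)%N then th j else 0.

(** The density of the noise translated by [truncseq D th] with respect to the noise itself. *)
Definition lik (D : nat) (th : nat -> R) (x : seqspace) : R :=
  \prod_(j < D) expR (th j * x j - th j ^+ 2 / 2).

Lemma lik_ge0 D th x : 0 <= lik D th x.
Proof. by apply: prodr_ge0 => j _; exact: expR_ge0. Qed.

Lemma measurable_lik D th : measurable_fun setT (lik D th).
Proof.
apply: measurable_prod => j _; apply: measurableT_comp => //.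
apply: measurable_funB => //; apply: measurable_funM => //.
exact: measurable_coord.
Qed.

(** Induction on [D]: the shift of coordinate [D] is split off into [f'], and it leaves the
    likelihood ratio of the earlier coordinates unchanged. *)
Lemma ge0_integral_shift D th (f : seqspace -> \bar R) :
  measurable_fun setT f -> (forall x, (0 <= f x)%E) ->
  (\int[P]_w f (translate (truncseq D th) (noise w)) =
   \int[P]_w (f (noise w) * (lik D th (noise w))%:E))%E.
Proof.
elim: D f => [|D IH] f mf f0.
  apply: eq_integral => w _; rewrite /lik big_ord0 mule1; congr f.
  by apply/funext => j; rewrite /translate /truncseq ltn0 add0r.
pose e i := if i == D then th D else 0.
pose f' x := f (translate e x).
transitivity (\int[P]_w f' (translate (truncseq D th) (noise w)))%E.
  apply: eq_integral => w _; congr f; apply/funext => j.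
  rewrite /translate /truncseq /e ltnS leq_eqVlt.
  by case: eqP => [->|_] /=; rewrite ?ltnn add0r.
have mf' : measurable_fun setT f'.
  exact: (measurableT_comp mf (measurable_translate e)).
rewrite (IH f' mf' (fun x => f0 _)).
pose g x := (f x * (lik D th x)%:E)%E.
transitivity (\int[P]_w g (translate e (noise w)))%E.
  apply: eq_integral => w _; rewrite /g; congr (_ * _%:E)%E.
  apply: eq_bigr => j _; rewrite /translate /e.
  by rewrite (ltn_eqF (ltn_ord j)) add0r.
rewrite (ge0_integral_shift1 D (th D) g).
- apply: eq_integral => w _.
  by rewrite /g -muleA -EFinM /lik big_ord_recr.
- apply: emeasurable_funM => //.
  by apply/measurable_EFinP; exact: measurable_lik.
- by move=> x; rewrite mule_ge0// lee_fin lik_ge0.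
Qed.

(** * Probabilities under a shift, and moments of the likelihood ratio *)

Definition pr (th : nat -> R) (A : set seqspace) : R :=
  fine (P [set w | A (translate th (noise w))]).

Lemma measurable_translate_noise th :
  measurable_fun setT (fun w => translate th (noise w)).
Proof. exact: (measurableT_comp (measurable_translate th) measurable_noise). Qed.

Lemma measurable_pr th (A : set seqspace) : measurable A ->
  measurable [set w | A (translate th (noise w))].
Proof.
move=> mA; have := measurable_translate_noise th measurableT _ mA.
by rewrite setTI.
Qed.

Lemma prE th (A : set seqspace) : measurable A ->
  P [set w | A (translate th (noise w))] = (pr th A)%:E.
Proof.
by move=> mA; rewrite fineK//; apply: fin_num_measure; exact: measurable_pr.
Qed.

Lemma pr_ge0 th A : 0 <= pr th A.
Proof. exact: fine_ge0. Qed.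

Lemma pr_le th (A B : set seqspace) : measurable A -> measurable B ->
  A `<=` B -> pr th A <= pr th B.
Proof.
move=> mA mB AB; rewrite -lee_fin -!prE//.
by apply: le_measure => [||w /= /AB//]; rewrite inE; exact: measurable_pr.
Qed.

Lemma prU th (A B : set seqspace) : measurable A -> measurable B ->
  pr th (A `|` B) <= pr th A + pr th B.
Proof.
move=> mA mB; rewrite -lee_fin EFinD -!prE//; last exact: measurableU.
by apply: (measureU2 P); exact: measurable_pr.
Qed.

Lemma pr_bigcup th (F : (set seqspace)^nat) : (forall n, measurable (F n)) ->
  nondecreasing_seq F ->
  pr th (\bigcup_n F n `\` F m) @[m --> \oo] --> 0.
Proof.
move=> mF ndF.
pose G m := [set w | (\bigcup_n F n `\` F m) (translate th (noise w))].
have mG m : measurable (G m).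
  by apply: measurable_pr; apply: measurableD => //; exact: bigcupT_measurable.
have G0 : \bigcap_m G m = set0.
  rewrite -subset0 => w /= Gw.
  by have [[n _ Fn] _] := Gw 0%N I; have [_] := Gw n I; apply.
have : P \o G @ \oo --> P (\bigcap_m G m).
  apply: nonincreasing_cvg_mu => //.
  - by rewrite (le_lt_trans (probability_le1 _ _))// ltry.
  - by rewrite G0.
  - move=> m n mn; apply/subsetPset => w [Fw nFn]; split => // Fm; apply: nFn.
    by have /subsetPset := ndF _ _ mn; apply.
rewrite G0 measure0 => /fine_cvgP[_]; exact.
Qed.

(* Hence the second moment of the likelihood ratio is read off the mass of the
   translation by [2 * th], without using independence again. *)
Lemma lik_sqr D (th : nat -> R) x : lik D th x ^+ 2 =
  expR (\sum_(j < D) th j ^+ 2) * lik D (fun j => 2 * th j) x.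
Proof.
rewrite /lik expR_sum -prodrXl -big_split/=; apply: eq_bigr => j _.
by rewrite expr2 -!expRD; congr expR; field.
Qed.

Lemma integral_lik D th (A : set seqspace) : measurable A ->
  (\int[P]_w (\1_A (noise w) * lik D th (noise w))%:E = (pr (truncseq D th) A)%:E)%E.
Proof.
move=> mA; rewrite -prE//.
have mI : measurable_fun setT (fun x : seqspace => (\1_A x : R)%:E).
  by apply/measurable_EFinP; exact: measurable_indic.
under eq_integral do rewrite EFinM.
rewrite -(ge0_integral_shift D th _ mI) => [|x]; last by rewrite lee_fin.
have mS := measurable_pr (truncseq D th) A mA.
rewrite -[RHS](_ : (\int[P]_w
  (\1_[set w | A (translate (truncseq D th) (noise w))] w)%:E = _)%E) //.
by rewrite integral_indic// setIT.
Qed.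

Lemma pr_setT th : pr th setT = 1.
Proof.
by rewrite /pr (_ : [set w | _] = setT) ?probability_setT//; apply/seteqP.
Qed.

Lemma measurable_lik_noise D (th : nat -> R) :
  measurable_fun setT (fun w => lik D th (noise w)).
Proof. exact: (measurableT_comp (measurable_lik D th) measurable_noise). Qed.

Lemma measurable_indic_noise (A : set seqspace) : measurable A ->
  measurable_fun setT (fun w => \1_A (noise w) : R).
Proof.
by move=> mA; exact: (measurableT_comp (measurable_indic mA) measurable_noise).
Qed.

Lemma integral_likT D (th : nat -> R) :
  (\int[P]_w (lik D th (noise w))%:E = 1)%E.
Proof.
rewrite -(pr_setT (truncseq D th)) -integral_lik//.
by apply: eq_integral => w _; rewrite indicT mul1r.
Qed.

Lemma integral_lik_sqr D (th : nat -> R) :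
  (\int[P]_w (lik D th (noise w) ^+ 2)%:E =
   (expR (\sum_(j < D) th j ^+ 2))%:E)%E.
Proof.
under eq_integral do rewrite lik_sqr EFinM.
rewrite ge0_integralZl ?lee_fin ?expR_ge0//.
- by rewrite integral_likT mule1.
- by apply/measurable_EFinP; exact: measurable_lik_noise.
- by move=> w _; rewrite lee_fin lik_ge0.
Qed.

Lemma integral_indic_lik_sqr D (th : nat -> R) (A : set seqspace) (a b c : R) :
  measurable A -> 0 <= a -> 0 <= b -> 0 <= c ->
  (\int[P]_w (a * \1_A (noise w) + b * lik D th (noise w) ^+ 2 + c)%:E =
   (a * pr (fun=> 0%R) A + b * expR (\sum_(j < D) th j ^+ 2) + c)%:E)%E.
Proof.
move=> mA a0 b0 c0.
have mI := measurable_indic_noise _ mA.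
have mZ : measurable_fun setT (fun w => lik D th (noise w) ^+ 2).
  exact: (measurable_funX 2 (measurable_lik_noise D th)).
have I0 w : 0 <= a * \1_A (noise w) by rewrite mulr_ge0.
have Z0 w : 0 <= b * lik D th (noise w) ^+ 2 by rewrite mulr_ge0// sqr_ge0.
have maI : measurable_fun setT (fun w => (a * \1_A (noise w))%:E).
  by apply/measurable_EFinP; exact: measurable_funM.
have mbZ : measurable_fun setT (fun w => (b * lik D th (noise w) ^+ 2)%:E).
  by apply/measurable_EFinP; exact: measurable_funM.
under eq_integral do rewrite EFinD EFinD.
rewrite ge0_integralD//; first last.
- exact: emeasurable_funD.
- by move=> w _; rewrite adde_ge0// lee_fin.
rewrite ge0_integralD//; first last.
- by move=> w _; rewrite lee_fin.
- by move=> w _; rewrite lee_fin.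
rewrite integral_cst//= probability_setT mule1 !EFinD; congr (_ + _ + _)%E.
- under eq_integral do rewrite EFinM.
  rewrite ge0_integralZl ?lee_fin//; last by apply/measurable_EFinP.
  rewrite EFinM; congr (_ * _)%E.
  have -> : (fun=> 0%R) = truncseq 0 (fun=> 0%R : R).
    by apply/funext => j; rewrite /truncseq.
  rewrite -integral_lik//; apply: eq_integral => w _.
  by rewrite /lik big_ord0 mulr1.
- under eq_integral do rewrite EFinM.
  rewrite ge0_integralZl ?lee_fin//; last 2 first.
  + by apply/measurable_EFinP.
  + by move=> w _; rewrite lee_fin sqr_ge0.
  by rewrite integral_lik_sqr.
Qed.

(* The pointwise inequality is integrated with [z] the likelihood ratio and [i]
   the indicator of [A]; linear bounds of this form replace
   Cauchy-Schwarz. *)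
Lemma pr_truncseq_le D (th : nat -> R) (A : set seqspace) (a b c m : R) :
  measurable A -> 0 <= a -> 0 <= b -> 0 <= c -> 0 <= m ->
  (forall (i : bool) (z : R), 0 <= z ->
    i%:R * z + m * z <= a * i%:R + b * z ^+ 2 + c) ->
  pr (truncseq D th) A + m <=
    a * pr (fun=> 0) A + b * expR (\sum_(j < D) th j ^+ 2) + c.
Proof.
move=> mA a0 b0 c0 m0 h.
have mI := measurable_indic_noise _ mA; have mZ := measurable_lik_noise D th.
rewrite -lee_fin -integral_indic_lik_sqr//.
have -> : (pr (truncseq D th) A + m)%:E = (\int[P]_w
    (\1_A (noise w) * lik D th (noise w) + m * lik D th (noise w))%:E)%E.
  under eq_integral do rewrite EFinD.
  rewrite ge0_integralD//; last 4 first.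
  - by move=> w _; rewrite lee_fin mulr_ge0// lik_ge0.
  - by apply/measurable_EFinP; exact: measurable_funM.
  - by move=> w _; rewrite lee_fin mulr_ge0// lik_ge0.
  - by apply/measurable_EFinP; exact: measurable_funM.
  rewrite integral_lik// EFinD; congr (_ + _)%E.
  under eq_integral do rewrite EFinM.
  rewrite ge0_integralZl ?lee_fin//; last 2 first.
  - by apply/measurable_EFinP.
  - by move=> w _; rewrite lee_fin lik_ge0.
  by rewrite integral_likT mule1.
apply: ge0_le_integral => //.
- by move=> w _; rewrite lee_fin addr_ge0// mulr_ge0// lik_ge0.
- by apply/measurable_EFinP; apply: measurable_funD; exact: measurable_funM.
- apply/measurable_EFinP; apply: measurable_funD => //.
  apply: measurable_funD; first exact: measurable_funM.
  by apply: measurable_funM => //; exact: measurable_funX.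
- move=> w _; rewrite lee_fin indicE; apply: h; exact: lik_ge0.
Qed.

(** Pointwise, [z <= t * z ^+ 2] if [t * z >= 1], and [z <= t^-1] otherwise. The bound depends on
    [D] only through the energy of the shift, which allows a passage to infinitely many
    coordinates. *)
Lemma pr_truncseq_dominated D (th : nat -> R) (A : set seqspace) (t : R) :
  measurable A -> 0 < t ->
  pr (truncseq D th) A <=
    t * expR (\sum_(j < D) th j ^+ 2) + t^-1 * pr (fun=> 0) A.
Proof.
move=> mA t0.
rewrite [leRHS]addrC -[leLHS]addr0 -[leRHS]addr0.
apply: pr_truncseq_le => //; [by rewrite invr_ge0 ltW|exact: ltW|].
move=> i z z0; rewrite mul0r !addr0; case: i;
  rewrite ?mul0r ?mulr0 ?add0r ?mul1r ?mulr1.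
  have [tz|tz] := leP 1 (t * z).
    rewrite expr2 mulrA; apply: ler_wpDl; first by rewrite invr_ge0 ltW.
    by rewrite ler_peMl.
  apply: ler_wpDr; first by rewrite mulr_ge0 ?sqr_ge0// ltW.
  by rewrite -[leRHS]mul1r ler_pdivlMr// mulrC ltW.
by rewrite mulr_ge0 ?sqr_ge0// ltW.
Qed.

(** Integrates [i * (z - 1) <= t + t^-1 * (z - 1) ^+ 2]; the last factor of the bound is the
    variance of the likelihood ratio. *)
Lemma pr_truncseq_near0 D (th : nat -> R) (A : set seqspace) (t : R) :
  measurable A -> 0 < t ->
  pr (truncseq D th) A <=
    pr (fun=> 0) A + t + t^-1 * (expR (\sum_(j < D) th j ^+ 2) - 1).
Proof.
move=> mA t0; set S := expR _; set p := pr _ A; set p0 := pr _ A.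
have ti0 : 0 < t^-1 by rewrite invr_gt0.
(* The cross term of [t^-1 * (z - 1) ^+ 2] is moved to the left as [m = 2 * t^-1], so that all
   coefficients are nonnegative. *)
suff : p + 2 * t^-1 <= 1 * p0 + t^-1 * S + (t + t^-1) by lra.
apply: pr_truncseq_le => //; [exact: ltW| | |] ; try lra.
move=> i z z0.
have tti : t * t^-1 = 1 by rewrite divff// gt_eqF.
have sq : 0 <= t^-1 * (z - 1 - t) ^+ 2 by rewrite mulr_ge0 ?sqr_ge0// ltW.
have sq1 : 0 <= t^-1 * (z - 1) ^+ 2 by rewrite mulr_ge0 ?sqr_ge0// ltW.
have E : t^-1 * (z - 1 - t) ^+ 2 = t^-1 * (z - 1) ^+ 2 - 2 * (z - 1) + t.
  by rewrite -[in RHS](mulr1 t) -tti; field; rewrite gt_eqF.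
case: i => /=; rewrite ?mul0r ?mul1r; nra.
Qed.

(** * Approximation by cylinders, and shifts by infinite sequences *)

Definition cylinder (D : nat) (A : set seqspace) : Prop :=
  forall x y, (forall j, (j < D)%N -> x j = y j) -> A x -> A y.

Definition cylinders : set (set seqspace) :=
  [set A | measurable A /\ exists D, cylinder D A].

Lemma setI_closed_cylinders : setI_closed cylinders.
Proof.
move=> A B [mA [D cA]] [mB [E cB]]; split; first exact: measurableI.
exists (maxn D E) => x y xy [Ax Bx]; split.
  by apply: cA Ax => j jD; apply: xy; rewrite leq_max jD.
by apply: cB Bx => j jE; apply: xy; rewrite leq_max jE orbT.
Qed.

Lemma cylindersD A B : cylinders A -> cylinders B -> cylinders (A `\` B).
Proof.
move=> [mA [D cA]] [mB [E cB]]; split; first exact: measurableD.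
exists (maxn D E) => x y xy [Ax Bx]; split.
  by apply: cA Ax => j jD; apply: xy; rewrite leq_max jD.
by move=> By; apply: Bx; apply: cB By => j jE; rewrite xy// leq_max jE orbT.
Qed.

Lemma pr_cylinder D (th : nat -> R) (A : set seqspace) : cylinder D A ->
  pr th A = pr (truncseq D th) A.
Proof.
move=> cA; rewrite /pr; congr (fine (P _)); apply/seteqP.
by split => w /=; apply: cA => j jD; rewrite /translate /truncseq jD.
Qed.

Lemma pr_set0 th : pr th set0 = 0.
Proof. by rewrite /pr (_ : [set w | _] = set0) ?measure0. Qed.

(** One cylinder serves two shifts at once, since the laws under [th] and under [0] are to be
    compared on it. *)
Definition approximable (th eta : nat -> R) : set (set seqspace) :=
  [set A | measurable A /\ forall e, 0 < e ->
    exists2 C, cylinders C & pr th (A `+` C) + pr eta (A `+` C) <= e].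

(** Errors add up under differences of sets; an increasing union is first replaced by one [F m],
    with [m] large enough for both shifts. *)
Lemma lambda_approximable th eta : lambda_system setT (approximable th eta).
Proof.
split => //.
- split => // e e0; exists setT; first by split => //; exists 0%N.
  by rewrite setYK !pr_set0 addr0 ltW.
- move=> A B BA [mA hA] [mB hB]; split; first exact: measurableD.
  move=> e e0; have e2 : 0 < e / 2 by lra.
  have [C cC hC] := hA _ e2; have [C' cC' hC'] := hB _ e2.
  have [[mC _] [mC' _]] := (cC, cC').
  exists (C `\` C'); first exact: cylindersD.
  have sub : (A `\` B) `+` (C `\` C') `<=` (A `+` C) `|` (B `+` C').
    move=> x; rewrite /setY/= => -[[[Ax Bx] h]|[[Cx C'x] h]].
      have [Cx|Cx] := pselect (C x); last by left; left.
      by right; right; split => //; apply: contrapT => C'x; apply: h.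
    have [Ax|Ax] := pselect (A x); last by left; right.
    by right; left; split => //; apply: contrapT => Bx; apply: h.
  have le_ t : pr t ((A `\` B) `+` (C `\` C')) <= pr t (A `+` C) + pr t (B `+` C').
    apply: le_trans (prU _ _ _ _ _); try exact: measurableY.
    apply: pr_le => //; last by apply: measurableU; exact: measurableY.
    by apply: measurableY; exact: measurableD.
  by have := le_ th; have := le_ eta; lra.
- move=> F ndF hF; have mF n : measurable (F n) by case: (hF n).
  split; first exact: bigcupT_measurable.
  move=> e e0; have e4 : 0 < e / 4 by lra.
  have near_ t : \forall m \near \oo, pr t (\bigcup_n F n `\` F m) <= e / 4.
    have /cvgrPdist_le/(_ _ e4) := pr_bigcup t F mF ndF.
    apply: filterS => m; rewrite sub0r normrN ger0_norm//; exact: pr_ge0.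
  have [m1 _ hth] := near_ th; have [m2 _ heta] := near_ eta.
  have {}hth := hth _ (leq_maxl m1 m2); have {}heta := heta _ (leq_maxr m1 m2).
  set m := maxn m1 m2 in hth heta.
  have e2 : 0 < e / 2 by lra.
  have [C cC hC] := (hF m).2 _ e2; have [mC _] := cC.
  exists C => //.
  have mU : measurable (\bigcup_n F n) by exact: bigcupT_measurable.
  have sub : (\bigcup_n F n) `+` C `<=` (\bigcup_n F n `\` F m) `|` (F m `+` C).
    move=> x; rewrite /setY/= => -[[Ux Cx]|[Cx Ux]].
      by have [Fx|Fx] := pselect (F m x); [right; left|left].
    by right; right; split => // Fx; apply: Ux; exists m.
  have le_ t : pr t ((\bigcup_n F n) `+` C) <=
      pr t (\bigcup_n F n `\` F m) + pr t (F m `+` C).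
    apply: le_trans (prU _ _ _ _ _); last 2 first.
    - exact: measurableD.
    - exact: measurableY.
    apply: pr_le => //; first exact: measurableY.
    by apply: measurableU; [exact: measurableD|exact: measurableY].
  by have := le_ th; have := le_ eta; lra.
Qed.

Lemma cylinder_approx (th eta : nat -> R) (A : set seqspace) (e : R) :
  measurable A -> 0 < e ->
  exists2 C, cylinders C & pr th (A `+` C) + pr eta (A `+` C) <= e.
Proof.
move=> mA; suff [_] : approximable th eta A by apply.
apply: (@lambda_system_subset _ cylinders setI_closed_cylinders setT) => //.
- exact: lambda_approximable.
- move=> C cC; split; first by case: cC.
  by move=> r r0; exists C => //; rewrite setYK !pr_set0 addr0 ltW.
apply: (@sub_sigma_algebra2 _ _ _ coord_sets) mA => _ [j _ [B mB <-]]; split.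
  by apply: sub_sigma_algebra; exists j => //; exists B.
by exists j.+1 => x y xy [_ /= Bx]; split => //=; rewrite -xy.
Qed.

Lemma pr_leDY th (A C : set seqspace) : measurable A -> measurable C ->
  pr th A <= pr th C + pr th (A `+` C).
Proof.
move=> mA mC; have mY := measurableY _ _ mA mC.
apply: le_trans (prU _ _ _ mC mY).
apply: pr_le => //; first exact: measurableU.
move=> x Ax; have [Cx|Cx] := pselect (C x); first by left.
by right; left.
Qed.

(** On a cylinder [th] may be truncated, so [pr_truncseq_dominated] applies there; the general case
    follows by approximation under both [th] and [0]. *)
Lemma pr_dominated (th : nat -> R) (A : set seqspace) (S t : R) :
  measurable A -> 0 < t -> (forall N, \sum_(j < N) th j ^+ 2 <= S) ->
  pr th A <= t * expR S + t^-1 * pr (fun=> 0) A.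
Proof.
move=> mA t0 hS; apply/ler_addgt0Pr => e e0.
have ti0 : 0 < t^-1 by rewrite invr_gt0.
(* Exchanging [A] and [C] costs their distance once under [th] and [t^-1] times under [0]. *)
have r0 : 0 < e / (1 + t^-1) by rewrite divr_gt0//; lra.
have [C [mC [D cC]] hC] := cylinder_approx th (fun=> 0) A _ mA r0.
have h1 := pr_leDY th _ _ mA mC.
have h2 := pr_leDY (fun=> 0) _ _ mC mA.
have h3 := pr_truncseq_dominated D th C t mC t0.
rewrite -pr_cylinder// in h3.
have h4 : t * expR (\sum_(j < D) th j ^+ 2) <= t * expR S.
  by rewrite ler_pM2l// ler_expR.
rewrite setYC in h2.
have h5 : t^-1 * pr (fun=> 0) C <=
    t^-1 * pr (fun=> 0) A + t^-1 * pr (fun=> 0) (A `+` C).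
  by rewrite -mulrDr ler_pM2l.
have [p1 p2] := (pr_ge0 th (A `+` C),
  pr_ge0 (fun=> 0) (A `+` C)).
have h6 : pr th (A `+` C) + t^-1 * pr (fun=> 0) (A `+` C) <= e.
  have -> : e = (1 + t^-1) * (e / (1 + t^-1)) by field; lra.
  have : (1 + t^-1) * (pr th (A `+` C) + pr (fun=> 0) (A `+` C)) <=
    (1 + t^-1) * (e / (1 + t^-1)) by rewrite ler_pM2l//; lra.
  by apply: le_trans; nra.
lra.
Qed.

(** The cylinder [C] is chosen under the noise alone, hence before [th]. By [pr_dominated] it
    remains close to [A] under every [th] of energy at most [S], and on [C] only the first [D]
    coordinates count. *)
Lemma pr_near0 (A : set seqspace) (S e : R) : measurable A -> 0 < e ->
  exists D eps, 0 < eps /\ forall th : nat -> R,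
    (forall N, \sum_(j < N) th j ^+ 2 <= S) ->
    (forall j, (j < D)%N -> `|th j| <= eps) ->
    pr th A <= pr (fun=> 0) A + e.
Proof.
move=> mA e0.
(* With these [t] and [r], both terms of [pr_dominated] for the symmetric difference are at most
   [e / 8]. *)
pose t := e / 8 / expR S; have t0 : 0 < t by rewrite !divr_gt0// expR_gt0.
pose r := Num.min (e / 8) (t * (e / 8)).
have e8 : 0 < e / 8 by lra.
have r0 : 0 < r by rewrite lt_min e8 mulr_gt0.
have [C [mC [D cC]] hC] := cylinder_approx (fun=> 0) (fun=> 0) A _ mA r0.
pose u := e / 8; have u0 : 0 < u by rewrite /u; lra.
(* A head energy of at most [s] makes the variance term [u^-1 * (expR s - 1)] at most [u]. *)
pose s := ln (1 + u * u).
have s0 : 0 < s by rewrite ln_gt0// ltrDl mulr_gt0.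
have Es : expR s = 1 + u * u by rewrite lnK// posrE addr_gt0// mulr_gt0.
(* As [eps <= 1], each squared coordinate is at most [eps], so the head energy is at most
   [D * eps <= s]; the successor keeps the quotient meaningful for [D = 0]. *)
pose eps := Num.min 1 (s / D.+1%:R).
have eps0 : 0 < eps by rewrite lt_min ltr01 divr_gt0// ltr0n.
exists D, eps; split => // th hS heps.
have mY := measurableY _ _ mA mC.
have h1 := pr_leDY th _ _ mA mC.
have h2 := pr_leDY (fun=> 0) _ _ mC mA; rewrite setYC in h2.
have p0 := pr_ge0 (fun=> 0) (A `+` C).
have hr : pr (fun=> 0) (A `+` C) <= r by lra.
have h3 : pr th (A `+` C) <= e / 4.
  have := pr_dominated th _ S t mY t0 hS.
  have -> : t * expR S = e / 8 by rewrite /t divfK// gt_eqF// expR_gt0.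
  have : t^-1 * pr (fun=> 0) (A `+` C) <= e / 8.
    rewrite mulrC ler_pdivrMr// [leRHS]mulrC; apply: le_trans hr _.
    by rewrite /r ge_min lexx orbT.
  lra.
have hr8 : r <= e / 8 by rewrite /r ge_min lexx.
have h4 : pr th C <= pr (fun=> 0) C + u + u^-1 * (u * u).
  rewrite (pr_cylinder D)//.
  apply: le_trans (pr_truncseq_near0 D th C u mC u0) _.
  rewrite lerD2l ler_pM2l ?invr_gt0// lerBlDl.
  rewrite -Es ler_expR.
  apply: (@le_trans _ _ (\sum_(j < D) eps)).
    apply: ler_sum => j _; rewrite -real_normK ?num_real//.
    have := heps j (ltn_ord j); have : eps <= 1 by rewrite ge_min lexx.
    by have := normr_ge0 (th j); nra.
  rewrite sumr_const card_ord -mulr_natr.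
  apply: (@le_trans _ _ (s / D.+1%:R * D%:R)).
    by apply: ler_wpM2r => //; rewrite ge_min lexx orbT.
  rewrite mulrAC ler_pdivrMr ?ltr0n// ler_wpM2l ?ler_nat//; exact: ltW.
rewrite mulKf ?gt_eqF// in h4.
rewrite /u in h4; lra.
Qed.

(** * Tests *)

Section testing.
Context (sigma : R) (sigma_gt0 : 0 < sigma).

Definition scale (n : nat) : R := sigma * (Num.sqrt (n.+1)%:R)^-1.

Lemma scale_gt0 n : 0 < scale n.
Proof. by rewrite mulr_gt0// invr_gt0 sqrtr_gt0 ltr0n. Qed.

Lemma scale_sqr n : scale n ^+ 2 = sigma ^+ 2 / n.+1%:R.
Proof. by rewrite exprMn exprVn sqr_sqrtr// ler0n. Qed.

(* The rejection region in the coordinates where the noise has unit variance. *)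
Definition reject (n : nat) (K : (nat -> R) -> bool) : set seqspace :=
  [set x | K (fun j => scale n * x j)].

Lemma measurable_reject n K : is_test K -> measurable (reject n K).
Proof.
move=> mK.
have ms : measurable_fun setT
    (fun x : seqspace => (fun j => scale n * x j) : seqspace).
  apply: measurable_fun_seqspace => j; apply: measurable_funM => //.
  exact: measurable_coord.
have := ms measurableT _ (mK : measurable (_ : set seqspace)).
by rewrite setTI.
Qed.

Lemma obs_reject n (K : (nat -> R) -> bool) th w :
  is_true (K (obs xi sigma n th w)) =
  reject n K (translate (fun j => th j / scale n) (noise w)).
Proof.
rewrite /reject /=; congr (is_true (K _)); apply/funext => j.
by rewrite /obs /translate mulrDr (mulrC _ (th j / _)) divfK// gt_eqF// scale_gt0.
Qed.

Lemma measurable_obs_test n K th : is_test K ->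
  measurable [set w | K (obs xi sigma n th w)].
Proof.
move=> mK; have := measurable_pr (fun j => th j / scale n) _
  (measurable_reject n _ mK).
by congr measurable; apply/funext => w /=; rewrite obs_reject.
Qed.

Lemma alpha_errE n K : is_test K ->
  alpha_err P xi sigma n K = (pr (fun=> 0) (reject n K))%:E.
Proof.
move=> mK; rewrite -prE//; last exact: measurable_reject.
rewrite /alpha_err; congr (P _); apply/funext => w /=.
rewrite obs_reject; congr (reject _ _ (translate _ _)).
by apply/funext => j; rewrite mul0r.
Qed.

Lemma beta_errE n K th : is_test K ->
  beta_err P xi sigma n K th =
  (1 - pr (fun j => th j / scale n) (reject n K))%:E.
Proof.
move=> mK; have mA := measurable_reject n K mK.
rewrite EFinB -prE// -probability_setC; last first.
  exact: measurable_pr.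
rewrite /beta_err; congr (P _); apply/funext => w /=.
rewrite -obs_reject; apply/propext; split => [/negP//|h]; exact/negP.
Qed.

(** * Energy tests and the two implications *)

Definition energy (D : nat) (x : nat -> R) : R := \sum_(j < D) x j ^+ 2.

Lemma measurable_energy D :
  measurable_fun setT (energy D : seqspace -> R).
Proof.
by apply: measurable_sum => j; apply: measurable_funX; exact: measurable_coord.
Qed.

Definition energy_test (D : nat) (r : R) (y : nat -> R) : bool :=
  r < energy D y.

Lemma energy_test_is_test D r : is_test (energy_test D r).
Proof.
have := measurable_energy D measurableT _ (measurable_itv `]r, +oo[%R).
rewrite setTI; congr (measurable (_ : set seqspace)); apply/seteqP.
by split => x /=; rewrite in_itv/= andbT.
Qed.

(** Since [scale n] decreases to 0, the events of scaled energy below [r] increase to the whole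
    space, and continuity of the measure applies. *)
Lemma noise_energy_small (D : nat) (r : R) : 0 < r ->
  exists N, forall n, (N <= n)%N ->
  (P [set w | r <= scale n ^+ 2 * energy D (fun j => xi j w)]%R
    <= (4^-1)%:E)%E.
Proof.
move=> r0.
pose F n : set seqspace := [set x | scale n ^+ 2 * energy D x < r].
have mF n : measurable (F n).
  have := measurable_energy D measurableT _
    (measurable_itv `]-oo, (r / scale n ^+ 2)[%R).
  rewrite setTI; congr (measurable (_ : set seqspace)); apply/seteqP.
  by split => x /=; rewrite /F/= in_itv/= ltr_pdivlMr ?exprn_gt0 ?scale_gt0// mulrC.
have E0 x : 0 <= energy D x by apply: sumr_ge0 => j _; exact: sqr_ge0.
have ndF : nondecreasing_seq F.
  move=> m n mn; apply/subsetPset => x; rewrite /F/=; apply: le_lt_trans.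
  rewrite ler_wpM2r// !scale_sqr ler_wpM2l ?sqr_ge0//.
  by rewrite lef_pV2 ?posrE ?ltr0n// ler_nat.
have FT : \bigcup_n F n = setT.
  apply/seteqP; split => // x _.
  have := truncnS_gt (sigma ^+ 2 * energy D x / r).
  set n := Num.truncn _ => hn.
  exists n => //; rewrite /F/= scale_sqr mulrAC ltr_pdivrMr ?ltr0n//.
  by rewrite [ltRHS]mulrC -ltr_pdivrMr.
have /cvgrPdist_le/(_ _ (_ : 0 < 4^-1))[//|N _ hN] := pr_bigcup (fun=> 0) F mF ndF.
exists N => n Nn; have := hN n Nn.
rewrite sub0r normrN ger0_norm ?pr_ge0// FT -lee_fin -prE//; last exact: measurableD.
apply: le_trans; rewrite le_eqVlt; apply/orP; left; apply/eqP; congr (P _).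
apply/seteqP; split => w; rewrite /F /translate/=.
  move=> h; split => //; apply/negP; rewrite -leNgt.
  by under [fun j => 0 + _]eq_fun do rewrite add0r.
move=> [_ /negP]; rewrite -leNgt.
by under [fun j => 0 + _]eq_fun do rewrite add0r.
Qed.

(** A single [n] is enough: its test has power at least its level plus [2 * e] at all [th] in [U] of
    norm at least [r], while [pr_near0] allows only [e] when the head is small. *)
Lemma consistent_testing_small_head (U : set (nat -> R)) (rho : nat -> R)
    (K : nat -> (nat -> R) -> bool) :
  (forall th, U th -> in_l2 th) -> l2_bounded U ->
  rho @ \oo --> (0 : R) -> (forall n, is_test (K n)) ->
  (limn_esup (fun n =>
    (alpha_err P xi sigma n (K n) +
     ereal_sup [set beta_err P xi sigma n (K n) th | th in Vset U (rho n)])%E)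
     < 1%:E)%E ->
  forall r, 0 < r -> exists D eps, 0 < eps /\ forall th, U th ->
     (forall j, (j < D)%N -> `|th j| <= eps) -> l2norm th < r.
Proof.
move=> Ul2 [M UM] rho0 mK lt1 r r0.
have [_ [V [n0 _ Vn0] <-] supV] := ereal_inf_lt lt1.
have /cvgrPdist_le/(_ _ r0)[n1 _ hn1] := rho0.
pose n := maxn n0 n1.
have rn : rho n <= r.
  by have := hn1 n (leq_maxr _ _); rewrite sub0r normrN => /(le_trans (ler_norm _)).
set b := ereal_sup [set beta_err P xi sigma n (K n) th | th in Vset U (rho n)].
have ab : (alpha_err P xi sigma n (K n) + b < 1%:E)%E.
  apply: le_lt_trans supV; apply: ereal_sup_ubound; exists n => //.
  by apply: Vn0; exact: leq_maxl.
rewrite alpha_errE// in ab; set A := reject n (K n) in ab.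
have mA : measurable A by exact: measurable_reject.
have bP th : U th -> r <= l2norm th ->
    ((1 - pr (fun j => th j / scale n) A)%:E <= b)%E.
  move=> Uth rth; rewrite -beta_errE//; apply: ereal_sup_ubound; exists th => //.
  by split => //; exact: le_trans rth.
case: b ab bP => [b| |]; last 2 first.
- by [].
(* The supremum over no alternatives: all of [U] has norm below [r]. *)
- move=> _ bP; exists 0%N, 1; split => // th Uth _.
  by rewrite ltNge; apply/negP => /(bP _ Uth); rewrite leeNy_eq.
rewrite -EFinD lte_fin => ab bP.
pose e := (1 - (pr (fun=> 0) A + b)) / 2; have e0 : 0 < e by rewrite /e; lra.
(* For noise of unit variance the shift is [th / scale n], of norm at most [M / scale n]. *)
have [D [eps [eps0 near0]]] := pr_near0 A ((M / scale n) ^+ 2) e mA e0.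
have s0 := scale_gt0 n.
exists D, (eps * scale n); split; first by rewrite mulr_gt0.
move=> th Uth small; rewrite ltNge; apply/negP => /(bP _ Uth).
rewrite lee_fin; have := near0 (fun j => th j / scale n).
rewrite /e => h; suff : pr (fun j => th j / scale n) A <= pr (fun=> 0) A + e.
  by rewrite /e; lra.
apply: h.
  move=> N; under eq_bigr do rewrite exprMn.
  rewrite -mulr_suml exprMn ler_wpM2r ?sqr_ge0//.
  apply: le_trans (sum_sqr_le_l2norm _ N (Ul2 _ Uth)) _.
  by have := UM _ Uth; have := l2norm_ge0 th; nra.
move=> j jD; rewrite normrM normfV (gtr0_norm s0) ler_pdivrMr//; exact: small.
Qed.

(** Both errors of the energy test lie in the event that the scaled noise energy is at least the
    threshold, which has probability at most [4^-1]; their sum is at most [2^-1]. *)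
Lemma rel_compact_consistent_testing (U : set (nat -> R)) :
  (forall th, U th -> in_l2 th) -> l2_rel_compact U ->
  exists (rho : nat -> R) (K : nat -> (nat -> R) -> bool),
    (forall n, 0 < rho n) /\ rho @ \oo --> (0 : R) /\
    (forall n, is_test (K n)) /\
    (limn_esup (fun n =>
       (alpha_err P xi sigma n (K n) +
        ereal_sup [set beta_err P xi sigma n (K n) th | th in Vset U (rho n)])%E)
     < 1%:E)%E.
Proof.
move=> Ul2 Ucpt.
pose rho k : R := k.+1%:R^-1.
have rho_gt0 k : 0 < rho k by rewrite invr_gt0 ltr0n.
have [D hD] :=
  choice (fun k => @rel_compact_head R U (rho k) Ul2 Ucpt (rho_gt0 k)).
(* If the observed energy is at most [r] and the head of [th] at least [rho ^+ 2 / 2 = 4 * r], then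
   [4 * r <= 2 * r + 2 * noise], so the noise energy is again at least [r]. *)
pose r k := rho k ^+ 2 / 8.
have r_gt0 k : 0 < r k by rewrite divr_gt0// exprn_gt0.
have [N hN] := choice (fun k => noise_energy_small (D k) (r k) (r_gt0 k)).
have [m [Nm mlim]] := diagonal_index N.
exists (rho \o m), (fun n => energy_test (D (m n)) (r (m n))).
split; first by move=> n; exact: rho_gt0.
split.
  apply/cvgrPdist_le => e e0.
  have /cvgrPdist_le/(_ _ e0)[k0 _ hk0] := @cvg_harmonic R.
  have [n0 hn0] := mlim k0.
  by exists n0 => // n /hn0; exact: hk0.
split; first by move=> n; exact: energy_test_is_test.
have mT n k : measurable
    [set w | r k <= scale n ^+ 2 * energy (D k) (fun j => xi j w)].
  have mE : measurable_fun setT (fun w => energy (D k) (fun j => xi j w)).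
    exact: (measurableT_comp (measurable_energy (D k)) measurable_noise).
  have := mE measurableT _ (measurable_itv `[(r k / scale n ^+ 2), +oo[%R).
  rewrite setTI; congr measurable; apply/seteqP.
  split => w /=; rewrite in_itv/= andbT (@ler_pdivrMr _ (scale n ^+ 2));
    by rewrite ?exprn_gt0 ?scale_gt0// mulrC.
apply: (@le_lt_trans _ _ (2^-1)%:E); last by rewrite lte_fin; lra.
(* The upper limit is at most the supremum over [n >= N 0], where [N (m n) <= n] holds. *)
apply: ereal_inf_le; exists (ereal_sup [set (alpha_err P xi sigma n
     (energy_test (D (m n)) (r (m n))) +
   ereal_sup [set beta_err P xi sigma n (energy_test (D (m n)) (r (m n))) th
     | th in Vset U ((rho \o m) n)])%E | n in [set n | (N 0 <= n)%N]]).
  by exists [set n | (N 0 <= n)%N] => //; exists (N 0).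
apply: ge_ereal_sup => _ [n /= N0n <-].
have {}Nm := Nm n N0n; set k := m n in Nm *.
have hP := hN k n Nm.
have -> : (2^-1 : R)%:E = ((4^-1)%:E + (4^-1)%:E)%E.
  by rewrite -EFinD; congr EFin; lra.
have obsE th w : energy (D k) (obs xi sigma n th w) =
    \sum_(j < D k) (th j + scale n * xi j w) ^+ 2 by [].
apply: leeD.
  apply: le_trans hP; apply: le_measure; rewrite ?inE; last 2 first.
  - exact: mT.
  - move=> w /=; rewrite /energy_test obsE => /ltW /le_trans; apply.
    rewrite mulr_sumr; apply: ler_sum => j _.
    by rewrite add0r exprMn.
  by apply: measurable_obs_test; exact: energy_test_is_test.
apply: ge_ereal_sup => _ [th [Uth rth] <-].
apply: le_trans hP; apply: le_measure; rewrite ?inE; last 2 first.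
- exact: mT.
- move=> w /=; rewrite /energy_test obsE -leNgt => small.
  have := hD k th Uth rth.
  have : \sum_(j < D k) th j ^+ 2 <=
      2 * (\sum_(j < D k) (th j + scale n * xi j w) ^+ 2) +
      2 * (scale n ^+ 2 * energy (D k) (fun j => xi j w)).
    rewrite /energy !mulr_sumr -big_split/=; apply: ler_sum => j _.
    by have := sqr_ge0 (th j + 2 * (scale n * xi j w)); nra.
  by rewrite /r in small *; lra.
rewrite [X in measurable X](_ : _ = ~` [set w | energy_test (D k) (r k)
    (obs xi sigma n th w)]).
  by apply/measurableC/measurable_obs_test; exact: energy_test_is_test.
by apply/seteqP; split => w /= /negP.
Qed.

End testing.

End gaussian_noise.

Theorem theorem1 (R : realType) (sigma : R) (U : set (nat -> R))
  (d : measure_display) (Omega : measurableType d) (P : probability Omega R)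
  (xi : nat -> Omega -> R) :
  0 < sigma ->
  iid_std_normal P xi ->
  (forall th, U th -> in_l2 th) ->
  l2_bounded U -> l2_convex U -> center_symmetric U ->
  (exists (rho : nat -> R) (K : nat -> (nat -> R) -> bool),
      (forall n, 0 < rho n) /\ rho @ \oo --> (0 : R) /\
      (forall n, is_test (K n)) /\
      (limn_esup (fun n =>
         (alpha_err P xi sigma n (K n) +
          ereal_sup [set beta_err P xi sigma n (K n) th | th in Vset U (rho n)])%E)
       < 1%:E)%E)
  <-> l2_rel_compact U.
Proof.
move=> sigma_gt0 iid Ul2 Ubnd Uconv Usym; split.
  move=> [rho [K [_ [rho0 [mK lt1]]]]].
  apply: small_head_rel_compact => //.
  exact: (consistent_testing_small_head iid sigma sigma_gt0 U rho K).
exact: rel_compact_consistent_testing.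
Qed.
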